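(* Let $G$ be a finite $2$-group such that $\Delta(G)$ is triangle-free. Then $G$ has exponent at most $4$ and every element of $G$ of order $4$ is conjugate (in $G$) to its inverse.
   Context: All groups are finite. For a group $G$, the cyclic conjugacy class graph $\Delta(G)$ is the simple undirected graph whose vertices are the nontrivial conjugacy classes of $G$ (the classes $x^G$ with $1\ne x\in G$), where two distinct vertices $x^G$ and $y^G$ are adjacent when there exist $x'\in x^G$ and $y'\in y^G$ such that the subgroup $\langle x',y'\rangle$ is cyclic. A graph is triangle-free if it does not contain three distinct pairwise adjacent vertices. *)

(* Defs.v *)
From mathcomp Require Import all_boot all_fingroup all_solvable.

Set Implicit Arguments.
Unset Strict Implicit.
Unset Printing Implicit Defensive.

Local Open Scope group_scope.

(* A simple graph is given by its vertex set [V] inside an ambient finite type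
   and an adjacency relation [e], used only between elements of [V]. *)
Definition triangle_free (T : finType) (V : {set T}) (e : rel T) : Prop :=
  ~ exists a b c : T,
      [/\ a \in V, b \in V & c \in V] /\
      [/\ a != b, b != c & a != c] /\
      [/\ e a b, e b c & e a c].

Definition ccc_vertices (gT : finGroupType) (G : {group gT}) : {set {set gT}} :=
  [set x ^: G | x in G^#].

(* The relation does not mention [G]: vertices are literally the conjugacy
   classes, as subsets of [gT]. *)
Definition ccc_adj (gT : finGroupType) : rel {set gT} :=
  fun X Y => (X != Y) &&
    [exists x in X, exists y in Y, cyclic <<[set x; y]>>].

Definition ccc_triangle_free (gT : finGroupType) (G : {group gT}) : Prop :=
  triangle_free (ccc_vertices G) (@ccc_adj gT).

(* Main.v *)
Require Import Defs.
From mathcomp Require Import all_boot all_fingroup all_solvable.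

Local Open Scope group_scope.

(** Any two powers of one element generate a cyclic group, so three nontrivial powers of [x] in
    distinct classes form a triangle ([cycle_ccc_triangle]). An element of order at least 8 gives
    [x], [x ^+ 2], [x ^+ 4], told apart by their orders ([class_neq_order]). An element of order 4
    not conjugate to its inverse gives [x], [x^-1], [x ^+ 2]. *)

Lemma ccc_adj_cycle (gT : finGroupType) (G : {group gT}) (x y z : gT) :
  y \in <[x]> -> z \in <[x]> -> y ^: G != z ^: G -> ccc_adj (y ^: G) (z ^: G).
Proof.
move=> yx zx neq; rewrite /ccc_adj neq /=.
apply/existsP; exists y; rewrite class_refl /=.
apply/existsP; exists z; rewrite class_refl /=.
apply: cyclicS (cycle_cyclic x).
by rewrite gen_subG subUset !sub1set yx.
Qed.

Lemma class_neq_order (gT : finGroupType) (G : {group gT}) (x y : gT) :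
  #[x] != #[y] -> x ^: G != y ^: G.
Proof.
by apply: contraNneq => eq_cl; have := class_refl G x;
  rewrite eq_cl => /imsetP[g _ ->]; rewrite orderJ.
Qed.

(** Adjacency is automatic inside [<[x]>], so only distinctness of the classes has to be supplied;
    [x] is nontrivial because its power [y] is. *)
Lemma cycle_ccc_triangle (gT : finGroupType) (G : {group gT}) (x y z : gT) :
    ccc_triangle_free G -> x \in G -> y \in <[x]>^# -> z \in <[x]>^# ->
    x ^: G != y ^: G -> y ^: G != z ^: G -> x ^: G != z ^: G ->
  False.
Proof.
move=> tfG Gx /setD1P[nty yx] /setD1P[ntz zx] xy yz xz; apply: tfG.
have sxG : <[x]> \subset G by rewrite cycle_subG.
have ntx : x != 1.
  by apply: contraNneq nty => x1; move: yx; rewrite x1 cycle1 => /set1P->.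
exists (x ^: G), (y ^: G), (z ^: G).
split; last by split; split=> //; apply: (@ccc_adj_cycle _ G x);
  rewrite ?cycle_id.
by split; apply: imset_f; rewrite !inE ?ntx ?nty ?ntz ?Gx ?(subsetP sxG).
Qed.

Theorem theorem2 (gT : finGroupType) (G : {group gT}) :
  2.-group G -> ccc_triangle_free G ->
  (exponent G <= 4)%N /\
  (forall x : gT, x \in G -> #[x] = 4 -> exists2 g : gT, g \in G & x ^ g = x^-1).
Proof.
move=> pG tfG; split=> [|x Gx ox].
  (* A 2-group is nilpotent, so its exponent is the order [2 ^ k] of a single element. *)
  have [x Gx ox] := exponent_witness (pgroup_nil pG).
  have [k ok] := p_natP (mem_p_elt pG Gx).
  rewrite ox ok (@leq_exp2l 2 k 2) // leqNgt; apply/negP=> k_gt2.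
  have oX m : m <= 2 -> #[x ^+ (2 ^ m)] = (2 ^ (k - m))%N.
    move=> m_le2; have m_le_k : m <= k by apply: leq_trans m_le2 (ltnW k_gt2).
    by rewrite orderXdiv ok ?dvdn_exp2l // expnB.
  have ntX m : m <= 2 -> x ^+ (2 ^ m) \in <[x]>^#.
    move=> m_le2; rewrite !inE mem_cycle andbT -order_eq1 oX //.
    by rewrite -(expn0 2) eqn_exp2l // subn_eq0 -ltnNge (leq_ltn_trans m_le2).
  have neqX m n : m < n <= 2 -> (x ^+ (2 ^ m)) ^: G != (x ^+ (2 ^ n)) ^: G.
    case/andP=> m_lt_n n_le2; have m_le2 := leq_trans (ltnW m_lt_n) n_le2.
    apply: class_neq_order; rewrite !oX // eqn_exp2l // neq_ltn orbC.
    by rewrite ltn_sub2l // (leq_ltn_trans m_le2).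
  (* Here [x] is read as [x ^+ (2 ^ 0)], by conversion, so [neqX 0] applies. *)
  apply: (@cycle_ccc_triangle _ G x (x ^+ (2 ^ 1)) (x ^+ (2 ^ 2))) => //;
    by [apply: ntX | apply: (neqX 0) | apply: neqX].
have [/imsetP[g Gg xVg] | notJ] := boolP (x^-1 \in x ^: G); first by exists g.
have ox2 : #[x ^+ 2] = 2 by rewrite orderXdiv ox.
(* [x] and [x^-1] have equal order, so their classes are separated by [notJ]; [x ^+ 2] is separated
   from both by its order 2. *)
case: (@cycle_ccc_triangle _ G x x^-1 (x ^+ 2)) => //.
- by rewrite !inE groupV cycle_id -order_eq1 orderV ox.
- by rewrite !inE mem_cycle -order_eq1 ox2.
- by apply: contraNneq notJ => ->; apply: class_refl.
- by apply: class_neq_order; rewrite orderV ox ox2.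
by apply: class_neq_order; rewrite ox ox2.
Qed.
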